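(* If a semi-ideal $\mathcal I$ on $2^\omega$ contains all Borel thin subsets of $2^\omega$, then for any Polish group $X$ the semi-ideals $\mathcal{EHI}$ and $\mathcal{HI}$ on $X$ have the Steinhaus property.
   Context: All groups are Abelian, written additively; a Polish group is a topological group whose underlying space is Polish. A semi-ideal on a set $K$ is a nonempty family of subsets of $K$ closed under taking subsets. $2^\omega=\{0,1\}^\omega$ is the Cantor cube. A subset $T\subset 2^\omega$ is thin if for every $n\in\omega$ the restriction to $T$ of the map $2^\omega\to 2^{\omega\setminus\{n\}}$, $x\mapsto x|_{\omega\setminus\{n\}}$, is injective. A subset $A$ of a Polish group $X$ is (injectively) Haar-$\mathcal I$ if there is an (injective) continuous map $f:2^\omega\to X$ such that $f^{-1}(A+x)\in\mathcal I$ for all $x\in X$. $\mathcal{HI}$ (resp. $\mathcal{EHI}$) is the family of all subsets of Borel Haar-$\mathcal I$ (resp. Borel injectively Haar-$\mathcal I$) sets in $X$. A family $\mathcal F$ of subsets of a Polish group $X$ has the Steinhaus property if for every Borel subset $A\notin\mathcal F$ of $X$ the difference $A-A=\{a-b:a,b\in A\}$ is a neighborhood of zero in $X$.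
   Formalization: The claim for EHI is stated only for non-discrete Polish groups X: if X is discrete, no injective continuous map from the Cantor cube to X exists, so EHI is empty and the empty set violates the Steinhaus property. *)

(* Defs.v *)
From mathcomp Require Import all_boot all_order all_algebra.
From mathcomp Require Import all_classical all_reals.
From mathcomp Require Import topology tvs measurable_structure cantor.

Set Implicit Arguments.
Unset Strict Implicit.
Unset Printing Implicit Defensive.

Import GRing.Theory Num.Theory.
Local Open Scope classical_set_scope.
Local Open Scope ring_scope.

Definition borel (T : topologicalType) : set (set T) := <<s @open T >>.

Definition compatible_complete_metric (R : realType) (T : topologicalType)
    (d : T -> T -> R) : Prop :=
  [/\ (forall x y, d x y = 0 <-> x = y),
      (forall x y, d x y = d y x),
      (forall x y z, d x z <= d x y + d y z),
      (forall (x : T) (U : set T),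
         nbhs x U <-> exists2 e : R, 0 < e & [set y | d x y < e] `<=` U) &
      (forall u : nat -> T,
         (forall e : R, 0 < e -> exists N : nat,
            forall m n : nat, (N <= m)%N -> (N <= n)%N -> d (u m) (u n) < e) ->
         exists l : T, u @ \oo --> l)].

Definition polish_space (R : realType) (T : topologicalType) : Prop :=
  (exists d : T -> T -> R, compatible_complete_metric d) /\
  (exists2 D : set T, countable D & dense D).

Definition semi_ideal (K : Type) (I : set (set K)) : Prop :=
  I !=set0 /\ (forall A B : set K, I B -> A `<=` B -> I A).

Definition restrict_away (n : nat) (x : cantor_space) :
    {m : nat | m != n} -> bool := fun m => x (val m).

Definition thin (T : set cantor_space) : Prop :=
  forall n : nat, set_inj T (@restrict_away n).

Definition translate (X : topologicalZmodType) (A : set X) (x : X) : set X :=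
  [set a + x | a in A].

Definition haar (X : topologicalZmodType) (I : set (set cantor_space))
    (A : set X) : Prop :=
  exists2 f : cantor_space -> X, continuous f &
    forall x : X, I (f @^-1` translate A x).

Definition injectively_haar (X : topologicalZmodType)
    (I : set (set cantor_space)) (A : set X) : Prop :=
  exists f : cantor_space -> X, [/\ injective f, continuous f &
    forall x : X, I (f @^-1` translate A x)].

Definition HI (X : topologicalZmodType) (I : set (set cantor_space)) :
    set (set X) :=
  [set A | exists B : set X, [/\ borel B, haar I B & A `<=` B]].

Definition EHI (X : topologicalZmodType) (I : set (set cantor_space)) :
    set (set X) :=
  [set A | exists B : set X, [/\ borel B, injectively_haar I B & A `<=` B]].

Arguments HI : clear implicits.
Arguments EHI : clear implicits.

Definition discrete_space (T : topologicalType) : Prop :=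
  forall x : T, open [set x].

Definition steinhaus (X : topologicalZmodType) (F : set (set X)) : Prop :=
  forall A : set X, borel A -> ~ F A ->
    nbhs (0 : X) [set a - b | a in A & b in A].

(* Main.v *)
Require Import Defs.
From mathcomp Require Import all_boot all_order all_algebra.
From mathcomp Require Import all_classical all_reals.
From mathcomp Require Import topology tvs measurable_structure cantor.
From mathcomp Require Import lra.

(** Suppose that [A] is Borel and that [A - A] is not a neighbourhood of zero.
    Points outside [A - A] then exist arbitrarily close to zero, so there is a
    sequence [x] avoiding [A - A] that tends to zero as fast as one likes; the
    map sending a point [y] of the Cantor cube to the sum of the [x n] with
    [y n = true] is then well defined and continuous.  Two points of the cube
    that differ in the coordinate [n] alone have images differing by [x n], up
    to sign.  If both images lay in one translate of [A], then [x n] would be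
    in [A - A]; hence the preimage of each translate of [A] is thin.  It is
    also Borel, so it belongs to the semi-ideal, and [A] is Haar-I
    ([thin_witness]).

    The complete metric of a Polish group need not be translation invariant, so
    smallness of [x n] alone does not make the partial sums Cauchy.  Instead
    [x n] is chosen after the finitely many subsums of [x 0], ..., [x (n-1)],
    so small that translating any of them by [x n] moves it by less than
    [eps n] ([rapid_exists]).  Choosing [eps n] small against the mutual
    distances of the subsums of rank [n] keeps the limits of distinct subsums
    apart; so the map is injective as soon as no [x n] is zero
    ([rapid_lim_inj]).

    For injectively Haar-I sets the sequence must therefore also avoid zero,
    that is, [(A - A) `|` [set 0]] must fail to be a neighbourhood of zero.
    When [A] is nonempty this set is [A - A] itself; when [A] is empty it is
    [set 0], a neighbourhood of zero only if the group is discrete. *)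

Set Implicit Arguments.
Unset Strict Implicit.
Unset Printing Implicit Defensive.

Import Order.TTheory GRing.Theory Num.Theory.
Local Open Scope classical_set_scope.
Local Open Scope ring_scope.

(** * Compatible complete metrics *)

Lemma metric_ball_nbhs (R : realType) (T : topologicalType) (d : T -> T -> R)
    (x : T) (e : R) :
  compatible_complete_metric d -> 0 < e -> nbhs x [set y | d x y < e].
Proof. by move=> [_ _ _ dnbhs _] e0; apply/dnbhs; exists e. Qed.

Lemma metric_ge0 (R : realType) (T : topologicalType) (d : T -> T -> R)
    (x y : T) :
  compatible_complete_metric d -> 0 <= d x y.
Proof.
move=> [d0 dC dtri _ _]; have := dtri x y x; rewrite [d y x]dC.
by have /d0 -> : x = x by []; move=> ?; lra.
Qed.

Lemma metric_hausdorff (R : realType) (T : topologicalType) (d : T -> T -> R) :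
  compatible_complete_metric d -> hausdorff_space T.
Proof.
move=> dX p q pq; have [d0 dC dtri _ _] := dX.
apply/d0/eqP; rewrite eq_le metric_ge0// andbT leNgt; apply/negP => dpq.
have dpq2 : 0 < d p q / 2 by lra.
have [r [/= pr qr]] := pq _ _ (metric_ball_nbhs p dX dpq2)
  (metric_ball_nbhs q dX dpq2).
by have := dtri p r q; rewrite [d r q]dC; lra.
Qed.

(** Closed balls are sequentially closed; this passes bounds on partial sums
    to their limits. *)
Lemma metric_lim_le (R : realType) (T : topologicalType) (d : T -> T -> R)
    (u : nat -> T) (a l : T) (N : nat) (c : R) :
    compatible_complete_metric d -> u @ \oo --> l ->
  (forall m, (N <= m)%N -> d a (u m) <= c) -> d a l <= c.
Proof.
move=> dX ul uc; have [_ dC dtri _ _] := dX.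
rewrite leNgt; apply/negP => cdal.
have e0 : 0 < d a l - c by lra.
have [M _ uM] := ul _ (metric_ball_nbhs l dX e0).
have /= lu := uM (maxn M N) (leq_maxl _ _).
have := uc (maxn M N) (leq_maxr _ _); have := dtri a (u (maxn M N)) l.
by rewrite [d (u _) l]dC; lra.
Qed.

Lemma cvg_sub (T : Type) (F : set_system T) (X : topologicalZmodType)
    (u v : T -> X) (a b : X) :
  Filter F -> u @ F --> a -> v @ F --> b -> (u t - v t) @[t --> F] --> a - b.
Proof.
move=> FF ua vb.
apply: (@continuous2_cvg _ X X X _ _ _ _ (fun r s => r - s) _ _ _ ua vb).
exact: (@sub_continuous X (a, b)).
Qed.

(** * Subsums of a sequence in an abelian group *)

Definition subsum (X : zmodType) (x : nat -> X) (y : cantor_space) (n : nat) :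
    X := \sum_(i < n) x i *+ y i.

Lemma subsumS (X : zmodType) (x : nat -> X) (y : cantor_space) (n : nat) :
  subsum x y n.+1 = subsum x y n + x n *+ y n.
Proof. by rewrite /subsum big_ord_recr. Qed.

Lemma eq_subsum (X : zmodType) (x : nat -> X) (y z : cantor_space) (n : nat) :
  (forall i, (i < n)%N -> y i = z i) -> subsum x y n = subsum x z n.
Proof. by move=> yz; apply: eq_bigr => i _; rewrite yz. Qed.

(** The source of thinness: changing one coordinate of [y] translates all later
    subsums by the same element. *)
Lemma subsum_flip (X : zmodType) (x : nat -> X) (y z : cantor_space)
    (n m : nat) :
    (forall i, i != n -> y i = z i) -> y n = true -> z n = false ->
  (n < m)%N -> subsum x y m - subsum x z m = x n.
Proof.
move=> yz yn zn nm; rewrite /subsum -sumrB.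
rewrite (bigD1 (Ordinal nm))//= yn zn mulr1n mulr0n subr0.
rewrite big1 ?addr0// => i /eqP ni; rewrite yz ?subrr//.
by apply/eqP => /= ni'; apply: ni; apply/val_inj.
Qed.

(** * Rapidly converging subsums *)

(** The radii [eps] halve at each step, so from rank [n] on the subsums along
    [y] move by at most [2 * eps n] in total.  The last clause takes [4 * eps n]
    so that the balls of radius [2 * eps n] around distinct subsums of rank [n],
    which contain all the limits branching from them, are disjoint. *)
Definition rapid (R : realType) (X : zmodType) (d : X -> X -> R)
    (x : nat -> X) (eps : nat -> R) : Prop :=
  [/\ (forall n, 0 < eps n),
      (forall n, 2 * eps n.+1 <= eps n),
      (forall n y, d (subsum x y n) (subsum x y n.+1) < eps n) &
      (forall n y z, subsum x y n <> subsum x z n ->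
         4 * eps n < d (subsum x y n) (subsum x z n))].

Lemma rapid_eps_small (R : realType) (X : zmodType) (d : X -> X -> R)
    (x : nat -> X) (eps : nat -> R) (e : R) :
  rapid d x eps -> 0 < e -> exists n, eps n < e.
Proof.
move=> [eps0 epsS _ _] ?.
(* A linear lower bound on the geometric decay is enough here. *)
have epsn n : n.+1%:R * eps n <= eps 0%N.
  elim: n => [|n IH]; first by rewrite mul1r.
  apply: le_trans IH; apply: le_trans (ler_wpM2l (ler0n _ _) (epsS n)).
  rewrite mulrA; apply: ler_wpM2r; first exact: ltW.
  by rewrite -natrM ler_nat muln2 -addnn addnS !ltnS leq_addl.
have ee : 0 <= eps 0%N / e by rewrite divr_ge0// ltW.
have := archi_boundP ee; set n := Num.bound _.
rewrite ltr_pdivrMr// => en; exists n; rewrite ltNge; apply/negP => en'.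
have := epsn n; have := eps0 n; have := ler_wpM2l (ler0n R n) en'.
by rewrite -natr1; lra.
Qed.

Lemma rapid_dist (R : realType) (X : topologicalZmodType) (d : X -> X -> R)
    (x : nat -> X) (eps : nat -> R) (y : cantor_space) (n m : nat) :
    compatible_complete_metric d -> rapid d x eps -> (n <= m)%N ->
  d (subsum x y n) (subsum x y m) <= 2 * eps n.
Proof.
move=> [d0 _ dtri _ _] [eps0 epsS step _] /subnKC <-.
set k := (m - n)%N.
(* Strengthened for the induction: the right side dominates the sum of the
   radii from n to n + k - 1. *)
suff : d (subsum x y n) (subsum x y (n + k)) <= 2 * eps n - 2 * eps (n + k)%N.
  by have := eps0 (n + k)%N; lra.
elim: k => [|k IH]; first by rewrite addn0 (d0 _ _).2// subrr.
have := dtri (subsum x y n) (subsum x y (n + k)) (subsum x y (n + k).+1).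
by rewrite addnS; have := step (n + k)%N y; have := epsS (n + k)%N; lra.
Qed.

Lemma rapid_cvg (R : realType) (X : topologicalZmodType) (d : X -> X -> R)
    (x : nat -> X) (eps : nat -> R) (y : cantor_space) :
    compatible_complete_metric d -> rapid d x eps ->
  exists l : X, subsum x y @ \oo --> l.
Proof.
move=> dX rx; have [_ dC dtri _ dcomp] := dX; apply: dcomp => e e0.
have e4 : 0 < e / 4 by lra.
have [n en] := rapid_eps_small rx e4; exists n => i j ni nj.
have := dtri (subsum x y i) (subsum x y n) (subsum x y j).
rewrite [d _ (subsum x y n)]dC.
by have := rapid_dist y dX rx ni; have := rapid_dist y dX rx nj; lra.
Qed.

Lemma rapid_lim_dist (R : realType) (X : topologicalZmodType) (d : X -> X -> R)
    (x : nat -> X) (eps : nat -> R) (y : cantor_space) (l : X) (n : nat) :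
    compatible_complete_metric d -> rapid d x eps ->
  subsum x y @ \oo --> l -> d (subsum x y n) l <= 2 * eps n.
Proof.
move=> dX rx yl; apply: (@metric_lim_le _ _ _ _ _ _ n _ dX yl) => m nm.
exact: rapid_dist.
Qed.

(** The limit is within [2 * eps n] of the subsum of rank [n], which depends on
    the first [n] coordinates only: a uniform limit of locally constant maps. *)
Lemma rapid_lim_continuous (R : realType) (X : topologicalZmodType)
    (d : X -> X -> R) (x : nat -> X) (eps : nat -> R) (f : cantor_space -> X) :
    compatible_complete_metric d -> rapid d x eps ->
    (forall y, subsum x y @ \oo --> f y) -> continuous f.
Proof.
move=> dX rx fl y; have [_ dC dtri dnbhs _] := dX.
move=> U /dnbhs[e e0 eU]; have e4 : 0 < e / 4 by lra.
have [n en] := rapid_eps_small rx e4.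
have : nbhs y [set z : cantor_space | forall i, (i < n)%N -> y i = z i].
  elim: n {en} => [|n IH]; first by apply: filterS filterT => z.
  have yn : nbhs y [set z : cantor_space | y n = z n].
    apply: (@proj_continuous nat (fun=> bool) n y [set b | y n = b]).
    by apply: open_nbhs_nbhs; split => [|/=]; first exact: discrete_open.
  apply: filterS (filterI IH yn) => z [/= yz yzn] i.
  by rewrite ltnS leq_eqVlt => /predU1P[->|/yz].
apply: filterS => z yz; apply: eU => /=.
have := rapid_lim_dist n dX rx (fl y); have := rapid_lim_dist n dX rx (fl z).
rewrite (eq_subsum x yz) => ? ?; have := dtri (f y) (subsum x z n) (f z).
by rewrite [d (f y) (subsum _ _ _)]dC; lra.
Qed.

(** At the first coordinate [n] where [y] and [z] differ, their subsums of rank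
    [n.+1] differ by [x n], and the separation of subsums survives in the
    limit. *)
Lemma rapid_lim_inj (R : realType) (X : topologicalZmodType)
    (d : X -> X -> R) (x : nat -> X) (eps : nat -> R) (f : cantor_space -> X) :
    compatible_complete_metric d -> rapid d x eps ->
    (forall y, subsum x y @ \oo --> f y) -> (forall n, x n <> 0) -> injective f.
Proof.
move=> dX rx fl x0 y z fyz; have [_ dC dtri _ _] := dX.
have [_ _ _ sep] := rx.
apply/funext => n; elim/ltn_ind: n => n IH; apply: contrapT => ynzn.
have /(sep n.+1) : subsum x y n.+1 <> subsum x z n.+1.
  rewrite !subsumS (eq_subsum x IH) => /addrI; move: ynzn.
  by case: (y n) (z n) => -[] //= _; rewrite mulr1n mulr0n => /esym?;
    apply: (x0 n).
have := rapid_lim_dist n.+1 dX rx (fl y).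
have := rapid_lim_dist n.+1 dX rx (fl z).
have := dtri (subsum x y n.+1) (f y) (subsum x z n.+1).
by rewrite -fyz [d (f y) (subsum x z _)]dC; lra.
Qed.

(** The identity for subsums passes to the limit because subtraction is
    continuous, whether or not the metric is invariant. *)
Lemma rapid_lim_flip (R : realType) (X : topologicalZmodType)
    (d : X -> X -> R) (x : nat -> X) (f : cantor_space -> X)
    (y z : cantor_space) (n : nat) :
    compatible_complete_metric d -> (forall y, subsum x y @ \oo --> f y) ->
    (forall i, i != n -> y i = z i) -> y n = true -> z n = false ->
  f y - f z = x n.
Proof.
move=> dX fl yz yn zn.
have sl : (subsum x y m - subsum x z m) @[m --> \oo] --> f y - f z.
  exact: cvg_sub.
apply: (cvg_unique (metric_hausdorff dX) sl).
apply: cvg_near_cst; exists n.+1 => // m /= nm.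
exact: subsum_flip.
Qed.

(** * Choosing a rapid sequence outside a set that is not a neighbourhood *)

Lemma small_translations (R : realType) (X : topologicalZmodType)
    (d : X -> X -> R) (S : seq X) (e : R) :
    compatible_complete_metric d -> 0 < e ->
  nbhs (0 : X) [set x | forall s, s \in S -> d s (s + x) < e].
Proof.
move=> dX e0; elim: S => [|s S IH]; first by apply: filterS filterT => x.
have ns : nbhs (0 : X) [set x | d s (s + x) < e].
  have cs : (s + x) @[x --> (0 : X)] --> s + 0.
    apply: (@continuous2_cvg _ X X X _ _ _ _ +%R _ _ _ (cvg_cst s) cvg_id).
    exact: (@add_continuous X (s, 0)).
  rewrite addr0 in cs; exact: cs _ (metric_ball_nbhs s dX e0).
apply: filterS (filterI ns IH) => x [/= sx Sx] t.
by rewrite inE => /predU1P[->|/Sx].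
Qed.

Lemma finite_separation (R : realType) (X : topologicalZmodType)
    (d : X -> X -> R) (S : seq (X * X)) (e : R) :
    compatible_complete_metric d -> 0 < e ->
  exists e' : R, [/\ 0 < e', e' <= e &
    forall p, p \in S -> p.1 <> p.2 -> e' < d p.1 p.2].
Proof.
move=> dX e0; have [d0 _ _ _ _] := dX.
elim: S => [|p S [e' [e'0 e'e e'S]]]; first by exists e.
have [pp|pp] := pselect (p.1 = p.2).
  by exists e'; split => // q; rewrite inE => /predU1P[->|/e'S].
have dp : 0 < d p.1 p.2.
  by rewrite lt_neqAle metric_ge0// andbT eq_sym; apply/eqP => /d0.
exists (Num.min e' (d p.1 p.2 / 2)); split.
- by rewrite lt_min e'0/=; lra.
- by rewrite ge_min e'e.
- move=> q; rewrite inE gt_min => /predU1P[->|qS] qq.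
    by apply/orP; right; lra.
  by rewrite e'S.
Qed.

(** Dependent choice over states [(x, (S, e))], where [x] is the latest term,
    [S] lists the subsums so far and [e] is the radius for the next step. *)
Lemma rapid_exists (R : realType) (X : topologicalZmodType) (d : X -> X -> R)
    (E : set X) :
    compatible_complete_metric d -> ~ nbhs (0 : X) E ->
  exists (x : nat -> X) (eps : nat -> R), rapid d x eps /\ forall n, ~ E (x n).
Proof.
move=> dX nE.
pose next (a b : X * (seq X * R)) := 0 < a.2.2 ->
  [/\ ~ E b.1,
      (forall s, s \in a.2.1 -> d s (s + b.1) < a.2.2),
      b.2.1 = a.2.1 ++ [seq s + b.1 | s <- a.2.1],
      0 < b.2.2 /\ 2 * b.2.2 <= a.2.2 &
      (forall s t, s \in b.2.1 -> t \in b.2.1 -> s <> t -> 4 * b.2.2 < d s t)].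
have nextP a : {b | next a b}.
  apply: cid; case: a => x0 [S e] /=.
  (* A state with a nonpositive radius is never reached, and [next] asks nothing
     of its successor. *)
  have [e0|e0] := ltP 0 e; last by exists (x0, (S, e)); rewrite /next/= ltNge e0.
  have [x [Sx nEx]] : exists x, (forall s, s \in S -> d s (s + x) < e) /\ ~ E x.
    apply: contrapT => /forallNP h; apply: nE.
    apply: filterS (small_translations S dX e0) => x Sx.
    by apply: contrapT => nEx; apply: (h x).
  pose S' := S ++ [seq s + x | s <- S].
  have [e' [e'0 e'e sep]] :=
    finite_separation [seq (s, t) | s <- S', t <- S'] dX e0.
  exists (x, (S', e' / 4)) => _; split => //=.
  - by split; lra.
  - move=> s t sS tS st.
    by have := sep (s, t) (allpairs_f _ sS tS) st; rewrite /=; lra.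
have [a [a0 aS]] := dependent_choice nextP (0, ([:: 0], 1)).
have a_gt0 n : 0 < (a n).2.2.
  by elim: n => [|n /aS[]//]; rewrite ?a0// => _ _ _ [].
pose x n := (a n.+1).1.
have x_mem n (y : cantor_space) : subsum x y n \in (a n).2.1.
  elim: n y => [|n IH] y; first by rewrite a0 /subsum big_ord0 mem_head.
  have [_ _ -> _ _] := aS n (a_gt0 n).
  rewrite subsumS mem_cat; case: (y n); last by rewrite mulr0n addr0 IH.
  by rewrite mulr1n (map_f (fun s => s + (a n.+1).1) (IH y)) orbT.
have [d0 _ _ _ _] := dX.
exists x, (fun n => (a n).2.2); split; first split.
- exact: a_gt0.
- by move=> n; have [_ _ _ []] := aS n (a_gt0 n).
- move=> n y; rewrite subsumS; case: (y n).
    by rewrite mulr1n; have [_ + _ _ _] := aS n (a_gt0 n); apply.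
  by rewrite mulr0n addr0 (d0 _ _).2.
(* All subsums of rank 0 are 0, so the initial radius 1 separates them. *)
- case=> [|n] y z; first by rewrite /subsum !big_ord0.
  by have [_ _ _ _ sep] := aS n (a_gt0 n); exact: sep.
- by move=> n; have [] := aS n (a_gt0 n).
Qed.

(** * Thin preimages *)

(** The sets whose preimage is Borel form a sigma-algebra containing the open
    sets. *)
Lemma borel_preimage (S T : topologicalType) (f : S -> T) (A : set T) :
  continuous f -> borel A -> borel (f @^-1` A).
Proof.
move=> cf; have sS : sigma_algebra [set: S] (@borel S).
  exact: smallest_sigma_algebra.
have := @smallest_sub _ _ _ _ (sigma_algebra_image f sS).
move=> /(_ (@open T)) h /h; rewrite /image_set_system/= setTI; apply.
move=> U oU; rewrite /image_set_system/= setTI; apply: sub_sigma_algebra.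
by move/continuousP : cf; apply.
Qed.

Lemma preimage_translate (T : Type) (X : topologicalZmodType) (f : T -> X)
    (A : set X) (x : X) :
  f @^-1` translate A x = (fun y => f y - x) @^-1` A.
Proof.
apply/seteqP; split => y /=; first by move=> [a Aa <-]; rewrite addrK.
by move=> Afx; exists (f y - x) => //; rewrite subrK.
Qed.

(** Points of one fibre of the restriction away from [n] differ at most at [n];
    if they did differ there, [x n] would be a difference of elements of [A]. *)
Lemma thin_preimage (X : zmodType) (x : nat -> X) (g : cantor_space -> X)
    (A : set X) :
    (forall (y z : cantor_space) n, (forall i, i != n -> y i = z i) ->
       y n = true -> z n = false -> g y - g z = x n) ->
    (forall n, ~ [set a - b | a in A & b in A] (x n)) ->
  thin (g @^-1` A).
Proof.
move=> flip nA.
have no_flip n (y z : cantor_space) : A (g y) -> A (g z) ->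
    (forall i, i != n -> y i = z i) -> y n = true -> z n = false -> False.
  move=> Ay Az yz yn zn; apply: (nA n); rewrite -(flip y z n yz yn zn).
  by exists (g y) => //; exists (g z).
move=> n y z; rewrite !inE /= => Ay Az eq_yz.
have yz i : i != n -> y i = z i.
  by move=> ni; exact: (congr1 (fun h => h (exist _ i ni)) eq_yz).
apply/funext => i; have [->|/yz//] := eqVneq i n.
case yn: (y n); case zn: (z n) => //.
- by case: (no_flip n y z Ay Az yz yn zn).
- by case: (no_flip n z y Az Ay _ zn yn) => j /yz.
Qed.

(** The set [E] is [A - A] when only continuity is wanted, and [A - A] with zero
    added when the map is to be injective. *)
Lemma thin_witness (R : realType) (X : topologicalZmodType) (A E : set X) :
    polish_space R X -> borel A -> [set a - b | a in A & b in A] `<=` E ->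
    ~ nbhs (0 : X) E ->
  exists f : cantor_space -> X, [/\ continuous f, (E 0 -> injective f) &
    forall x, borel (f @^-1` translate A x) /\ thin (f @^-1` translate A x)].
Proof.
move=> [[d dX] _] bA AE nE.
have [x [eps [rx nEx]]] := rapid_exists dX nE.
have [f fl] := choice (fun y => rapid_cvg y dX rx).
have cf : continuous f := rapid_lim_continuous dX rx fl.
exists f; split => //.
  move=> E0; apply: (rapid_lim_inj dX rx fl) => n xn.
  by apply: (nEx n); rewrite xn.
move=> t; rewrite preimage_translate; split.
  apply: borel_preimage => // y.
  exact: (cvg_sub _ (cf y) (cvg_cst t)).
apply: (@thin_preimage _ x); last by move=> n /AE /nEx.
move=> y z n yz yn zn; rewrite opprB addrA subrK.
exact: (rapid_lim_flip dX fl).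
Qed.

(** By homogeneity, discreteness is decided at zero. *)
Lemma nbhs0_set1_discrete (X : topologicalZmodType) :
  nbhs (0 : X) [set 0] -> discrete_space X.
Proof.
move=> n0 x; rewrite openE => _ ->; rewrite /interior.
have cx : (y - x) @[y --> x] --> x - x.
  exact: (cvg_sub _ cvg_id (cvg_cst x)).
rewrite subrr in cx.
have nx : nbhs x [set y | y - x = 0] := cx _ n0.
by apply: filterS nx => y /= /eqP; rewrite subr_eq0 => /eqP.
Qed.

(* No continuous map from the Cantor cube to a discrete X is injective, so on
   such an X the family EHI is empty: it is not a semi-ideal, and the empty set
   refutes its Steinhaus property. Hence the premise on the first conjunct. *)
Theorem theorem11p4 (R : realType) (I : set (set cantor_space))
    (hI : semi_ideal I)
    (hthin : forall T : set cantor_space, borel T -> thin T -> I T)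
    (X : topologicalZmodType) (hX : polish_space R X) :
  (~ discrete_space X -> steinhaus (EHI X I)) /\ steinhaus (HI X I).
Proof.
split=> [nX|] A bA nA; apply: contrapT => nAA.
- have [nE|] := pselect (~ nbhs (0 : X)
      ([set a - b | a in A & b in A] `|` [set 0])).
    have [f [cf fi fA]] := thin_witness hX bA (@subsetUl _ _ _) nE.
    apply: nA; exists A; split => //; exists f; split => //.
      by apply: fi; right.
    by move=> x; have [] := fA x; exact: hthin.
  move=> /contrapT nE.
  have [[a Aa]|/nonemptyPn A0] := pselect (A !=set0).
    apply: nAA; apply: filterS nE => _ [//|->].
    by exists a => //; exists a => //; rewrite subrr.
  apply: nX; apply: nbhs0_set1_discrete; apply: filterS nE => y [|//].
  by rewrite A0 => -[].
- have [f [cf _ fA]] := thin_witness hX bA (@subset_refl _ _) nAA.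
  apply: nA; exists A; split => //; exists f => // x.
  by have [] := fA x; exact: hthin.
Qed.
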